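(* Every $C_5$-chain satisfies the Erdős–Hajnal Conjecture: for every $C_5$-chain $H$ there exists $\epsilon(H)>0$ such that every tournament $T$ not containing $H$ as a subtournament contains a transitive subtournament on at least $|T|^{\epsilon(H)}$ vertices.
   Context: Tournaments are finite; subtournament = induced subtournament; transitive = no directed cycle. Given an ordering of the vertex set of a tournament, an edge $(x,y)$ is backward if $y$ precedes $x$; a tournament on an ordered vertex set is determined by its set of backward edges. Product: for tournaments $H_1,H_2$ with disjoint vertex sets and injective $f_1:V(H_1)\to\mathbb{N}$, $f_2:V(H_2)\to\mathbb{N}$ with disjoint images, let $\theta_i$ order $V(H_i)$ by increasing $f_i$ and $\theta$ order $V(H_1)\cup V(H_2)$ by increasing value of $f_1$ on $V(H_1)$ and $f_2$ on $V(H_2)$; $H_1^{f_1}\oplus H_2^{f_2}$ is the tournament on $V(H_1)\cup V(H_2)$ whose backward edges under $\theta$ are exactly those of $H_1$ under $\theta_1$ together with those of $H_2$ under $\theta_2$. $C_5$-chain: let $H_l$ have vertices $h_1,\dots,h_6$ with backward edges under $(h_1,\dots,h_6)$ exactly $(h_4,h_1),(h_5,h_2),(h_5,h_1),(h_6,h_3)$; $\rho_1(h_i)=i$ for $i\le5$ and $\rho_1(h_6)=7$. For an integer $t\ge0$, let $P_{2t+1}$ have vertices $p_1,\dots,p_{2t+1}$ with backward edges under $(p_1,\dots,p_{2t+1})$ exactly $(p_{2i},p_{2i-1})$, $1\le i\le t$; $\rho_2(p_{2i+1})=2i+6$ ($0\le i\le t$) and $\rho_2(p_{2i})=2i+7$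 ($1\le i\le t$). A $C_5$-chain is a tournament $H_l^{\rho_1}\oplus P_{2t+1}^{\rho_2}$. *)

(* Defs.v *)
From HB Require Import structures.
From mathcomp Require Import all_boot all_order all_algebra.
From mathcomp Require Import reals exp.

Set Implicit Arguments.
Unset Strict Implicit.
Unset Printing Implicit Defensive.

Import Order.TTheory GRing.Theory Num.Theory.

(* [arc x y] is the edge (x, y), directed from x to y. *)
Record tournament := Tournament {
  vertex :> finType;
  arc : rel vertex;
  arc_irr : irreflexive arc;
  arc_total : forall x y, x != y -> arc x y (+) arc y x }.

Definition isomorphic (T1 T2 : tournament) : Prop :=
  exists2 f : T1 -> T2, bijective f & forall x y, arc (f x) (f y) = arc x y.

Section Induced.
Variables (T : tournament) (S : {set T}).

Definition induced_arc : rel {x : T | x \in S} :=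
  fun x y => arc (val x) (val y).

Fact induced_irr : irreflexive induced_arc.
Proof. by move=> x; rewrite /induced_arc arc_irr. Qed.

Fact induced_total x y : x != y -> induced_arc x y (+) induced_arc y x.
Proof. by move=> xy; apply: arc_total; rewrite val_eqE. Qed.

Definition induced : tournament := Tournament induced_irr induced_total.

End Induced.

Definition contains (T H : tournament) : Prop :=
  exists S : {set T}, isomorphic (induced S) H.

Definition transitive_tournament (T : tournament) : Prop :=
  forall c : seq T, c != [::] -> ~ ucycle (@arc T) c.

(* Orderings of a vertex set are given by injections into nat. *)
Definition backward (T : tournament) (pos : T -> nat) : rel T :=
  fun x y => arc x y && (pos y < pos x).

(* The tournament on V determined by the set B of its backward edges under
   the ordering pos; pairs of B that are not decreasing for pos are ignored. *)
Section FromBackward.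
Variables (V : finType) (pos : V -> nat) (pos_inj : injective pos).
Variable B : rel V.

Definition from_backward_arc : rel V :=
  fun x y => if pos x < pos y then ~~ B y x else (pos y < pos x) && B x y.

Fact from_backward_irr : irreflexive from_backward_arc.
Proof. by move=> x; rewrite /from_backward_arc ltnn. Qed.

Fact from_backward_total x y :
  x != y -> from_backward_arc x y (+) from_backward_arc y x.
Proof.
rewrite /from_backward_arc; case: ltngtP => [_|_|/pos_inj->]; rewrite ?eqxx //.
  by rewrite addNb addbb.
by rewrite addbN addbb.
Qed.

Definition from_backward : tournament :=
  Tournament from_backward_irr from_backward_total.

Lemma backward_from_backward :
  (forall x y, B x y -> pos y < pos x) ->
  @backward from_backward pos =2 B.
Proof.
move=> Bpos x y; rewrite /backward /= /from_backward_arc.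
case: ltngtP => [xy|yx|xy]; rewrite ?andbT ?andbF //=.
- by apply/esym/negbTE/negP => /Bpos; rewrite ltnNge ltnW.
- by apply/esym/negbTE/negP => /Bpos; rewrite xy ltnn.
Qed.

End FromBackward.

Section Product.
Variables (H1 H2 : tournament) (f1 : H1 -> nat) (f2 : H2 -> nat).
Hypotheses (f1_inj : injective f1) (f2_inj : injective f2).
Hypothesis f12_disj : forall x y, f1 x != f2 y.

Definition product_pos (u : H1 + H2) : nat :=
  match u with inl x => f1 x | inr y => f2 y end.

Fact product_pos_inj : injective product_pos.
Proof.
move=> [x|x] [y|y] /= => [/f1_inj->|/eqP|/esym/eqP|/f2_inj->] //.
  by rewrite (negbTE (f12_disj _ _)).
by rewrite (negbTE (f12_disj _ _)).
Qed.

Definition product_backward : rel (H1 + H2)%type :=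
  fun u v => match u, v with
    | inl x, inl y => backward f1 x y
    | inr x, inr y => backward f2 x y
    | _, _ => false
    end.

Definition product : tournament :=
  from_backward product_pos_inj product_backward.

Lemma backward_product : @backward product product_pos =2 product_backward.
Proof.
by apply: backward_from_backward => -[x|x] [y|y] //= /andP[].
Qed.

End Product.

(* The vertices h_1, ..., h_6 are the elements of 'I_6, h_k being the ordinal of
   value k - 1; likewise for p_1, ..., p_(2t+1) below. *)
Definition Hl_backward : rel 'I_6 :=
  fun x y => (x.+1, y.+1) \in [:: (4, 1); (5, 2); (5, 1); (6, 3)].

Definition Hl : tournament := from_backward (@ord_inj 6) Hl_backward.

Definition rho1 (x : Hl) : nat := if (x : 'I_6).+1 <= 5 then (x : 'I_6).+1 else 7.

Definition P_backward (t : nat) : rel 'I_(2 * t + 1) :=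
  fun x y => has (fun i => (x.+1 == 2 * i) && (y.+1 == 2 * i - 1)) (iota 1 t).

Definition Podd (t : nat) : tournament :=
  from_backward (@ord_inj (2 * t + 1)) (@P_backward t).

(* With k the index of the vertex p_k, [k./2] is i for k = 2i and k = 2i + 1. *)
Definition rho2 (t : nat) (x : Podd t) : nat :=
  let k := (x : 'I_(2 * t + 1)).+1 in
  if odd k then 2 * k./2 + 6 else 2 * k./2 + 7.

Fact rho1_inj : injective rho1.
Proof.
move=> x y E; apply/eqP; move: E; rewrite /rho1.
by case: x => [[|[|[|[|[|[|]]]]]] ?] //; case: y => [[|[|[|[|[|[|]]]]]] ?].
Qed.

Fact rho2_inj t : injective (@rho2 t).
Proof.
have inj k l : (if odd k then 2 * k./2 + 6 else 2 * k./2 + 7) =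
    (if odd l then 2 * l./2 + 6 else 2 * l./2 + 7) -> k = l.
  rewrite !mul2n => E.
  rewrite -(odd_double_half k) -(odd_double_half l); move: E.
  case: (odd k); case: (odd l) => E.
  - by move/addIn: E => ->.
  - by move/(congr1 odd): E; rewrite !oddD !odd_double.
  - by move/(congr1 odd): E; rewrite !oddD !odd_double.
  - by move/addIn: E => ->.
by move=> x y /inj[E]; apply: val_inj.
Qed.

Fact rho12_disj t (x : Hl) (y : Podd t) : rho1 x != rho2 y.
Proof.
suff disj k : 0 < k -> rho1 x != (if odd k then 2 * k./2 + 6 else 2 * k./2 + 7).
  exact: disj.
rewrite /rho1 mul2n => k_gt0; case: ifP => [x5|_].
  rewrite neq_ltn; apply/orP; left; apply: leq_ltn_trans x5 _.
  by case: ifP => _; rewrite addnC.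
case: ifP => [_|k_even].
  by apply/eqP => /(congr1 odd); rewrite oddD odd_double.
rewrite -[X in X != _]add0n eqn_add2r eq_sym double_eq0.
by case: k k_gt0 k_even => [|[|]].
Qed.

Definition C5_chain_of (t : nat) : tournament :=
  product rho1_inj (@rho2_inj t) (@rho12_disj t).

Definition C5_chain (H : tournament) : Prop :=
  exists t : nat, isomorphic H (C5_chain_of t).

Local Open Scope ring_scope.

Definition erdos_hajnal (R : realType) (H : tournament) : Prop :=
  exists eps : R, 0 < eps /\
    forall T : tournament, ~ contains T H ->
      exists S : {set T}, transitive_tournament (induced S) /\
        #|T|%:R `^ eps <= #|S|%:R.

(* Main.v *)
(* The vertices p_3, ..., p_(2t+1) of a C5-chain form a transitive tournament to
   which all the other vertices h_1, ..., h_6, p_1, p_2 are complete, so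
   essentially these eight vertices have to be found.

   In a minimal counterexample, the largest transitive subtournament of any set
   of linear size is almost as large as that of the whole tournament, hence no
   linear set is complete to another one, nor to or from a transitive set whose
   size is a constant fraction of the maximum.  A greedy embedding argument gives ten linear layers
   such that almost all the edges between two layers go forward.  Let M be a
   large transitive set in layer 2, cut into three consecutive parts.  There is
   a backward edge (y, x) from layer 5 to layer 0 such that x has a backward
   in-neighbour m3 in the last part of M and y a backward out-neighbour m1 in the
   first one.  Either x, m1, m3, y extend to a C5 by a vertex of the middle part
   of M, or one of m1, m3 forms with x and y a triangle of backward edges.  In
   both cases the remaining vertices are provided by backward edges between sets
   of common forward neighbours, which are still large. *)
Require Import Defs.
From mathcomp Require Import all_boot all_order all_algebra zify lra.
From mathcomp Require Import boolp reals exp.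
(* [path.arc] would otherwise hide [Defs.arc]. *)
Import Defs.

Set Implicit Arguments.
Unset Strict Implicit.
Unset Printing Implicit Defensive.

(** * Transitive subtournaments *)

(** Preserving arcs is enough: distinct vertices are joined by exactly one arc and loops are
    excluded, so such a map is injective and reflects arcs. *)
Definition embeds (H T : tournament) : Prop :=
  exists f : H -> T, forall u v, arc u v -> arc (f u) (f v).

Section Tournament.
Variable T : tournament.
Implicit Types (A B W : {set T}) (x y : T) (s : seq T).

Lemma arc_flip x y : x != y -> ~~ arc x y -> arc y x.
Proof. by move=> /arc_total; case: (arc x y). Qed.

Lemma arc_neq x y : arc x y -> x != y.
Proof. by apply: contraTneq => ->; rewrite arc_irr. Qed.

Lemma arc_asym x y : arc x y -> ~~ arc y x.
Proof. by move=> xy; have := arc_total (arc_neq xy); rewrite xy. Qed.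

Lemma embeds_contains (H : tournament) : embeds H T -> contains T H.
Proof.
case=> f f_arc.
have f_arcE u v : arc (f u) (f v) = arc u v.
  case: (eqVneq u v) => [->|uv]; first by rewrite !arc_irr.
  case E: (arc u v); first exact: f_arc.
  by apply/negbTE/arc_asym/f_arc; have := arc_total uv; rewrite E.
have f_inj : injective f.
  move=> u v E; apply/eqP; apply: contraT => /arc_total.
  by rewrite -!f_arcE E arc_irr.
exists (f @: setT).
have im (u : {x | x \in f @: setT}) : exists v, f v == val u.
  by case/imsetP: (valP u) => v _ ->; exists v.
exists (fun u => xchoose (im u)) => [|u v].
  have imf v : f v \in f @: setT by apply: imset_f.
  exists (fun v => exist _ (f v) (imf v)) => [u|v].
    by apply: val_inj; apply/eqP/(xchooseP (im u)).
  by apply: f_inj; apply/eqP/(xchooseP (im (exist _ (f v) (imf v)))).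
by rewrite -f_arcE (eqP (xchooseP (im u))) (eqP (xchooseP (im v))).
Qed.

(** Transitive sets are handled as sequences listed in their own order, so that they can be cut and
    concatenated. *)
Definition chain A s := pairwise (@arc T) s && all [in A] s.

Lemma chain_sub A B s : A \subset B -> chain A s -> chain B s.
Proof.
move=> /subsetP AB /andP[ch /allP sA]; rewrite /chain ch.
by apply/allP => x /sA /AB.
Qed.

Lemma chain_subseq A s1 s2 : subseq s1 s2 -> chain A s2 -> chain A s1.
Proof.
move=> s12 /andP[ch /allP sA]; rewrite /chain (subseq_pairwise s12 ch).
by apply/allP => x /(mem_subseq s12) /sA.
Qed.

Lemma chain_cat A s1 s2 : chain A s1 -> chain A s2 ->
  (forall x y, x \in s1 -> y \in s2 -> arc x y) -> chain A (s1 ++ s2).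
Proof.
move=> /andP[ch1 A1] /andP[ch2 A2] s12.
rewrite /chain pairwise_cat all_cat ch1 A1 ch2 A2 !andbT.
by apply/allrelP.
Qed.

(** Every arc raises the index in [s], so the index would increase strictly all the way around a
    directed cycle. *)
Lemma chain_transitive s : pairwise (@arc T) s ->
  transitive_tournament (induced [set x in s]).
Proof.
move=> ch c c0 /andP[cyc _].
pose r (u : induced [set x in s]) := index (val u) s.
have arc_r u v : arc u v -> r u < r v.
  have [us vs] : val u \in s /\ val v \in s.
    by have := (valP u, valP v); rewrite !inE => -[].
  move=> uv; rewrite ltnNge; apply/negP; rewrite leq_eqVlt => /orP[/eqP E|vu].
    have := @arc_neq (val u) (val v) uv.
    by rewrite -(nth_index (val u) us) -(nth_index (val u) vs) -/(r u) -/(r v) E eqxx.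
  have /(pairwiseP (val u)) := ch.
  move=> /(_ (r v) (r u)); rewrite !inE !index_mem us vs !nth_index // => /(_ isT isT vu).
  exact/negP/(@arc_asym (val u) (val v)).
case: c c0 cyc => // x p _ /= xp.
suff : r x < r x by rewrite ltnn.
have : path (fun u v => r u < r v) x (rcons p x) by apply: sub_path xp.
move=> /(order_path_min (fun v u w => @ltn_trans (r v) (r u) (r w))) /allP.
by apply; rewrite mem_rcons inE eqxx.
Qed.

Lemma chain_card s : pairwise (@arc T) s -> #|[set x in s]| = size s.
Proof.
move=> ch; rewrite cardsE; apply/card_uniqP.
by apply: pairwise_uniq ch => x; rewrite arc_irr.
Qed.

Lemma chain_ramsey k A : 2 ^ k <= #|A| -> exists2 s, chain A s & size s = k.+1.
Proof.
elim: k A => [|k IH] A.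
  by case/card_gt0P => x xA; exists [:: x]; rewrite /chain /= ?xA.
move=> Ak; have /card_gt0P[x xA] : 0 < #|A| by apply: leq_trans Ak; rewrite expn_gt0.
pose N := [set y in A | arc x y]; pose M := [set y in A | arc y x].
have /eqP : #|A| = 1 + (#|N| + #|M|).
  rewrite (cardsD1 x) xA; congr (_ + _).
  rewrite -cardsUI.
  have -> : N :&: M = set0.
    apply/setP => y; rewrite !inE; apply/negP => /andP[/andP[_ xy] /andP[_ yx]].
    by have := arc_asym xy; rewrite yx.
  rewrite cards0 addn0; apply: eq_card => y; rewrite !inE -andb_orr andbC.
  case: (y \in A) => //=; case: (eqVneq y x) => [->|yx]; first by rewrite arc_irr.
  by have := arc_total yx; case: (arc y x); case: (arc x y).
(* Two neighbourhoods of fewer than [2 ^ k] vertices would, together with [x], give at most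
   [2 ^ k.+1 - 1] vertices. The vertex [x] goes in front of a chain of out-neighbours or behind a
   chain of in-neighbours. *)
move=> EA; have [Nk|Mk] : 2 ^ k <= #|N| \/ 2 ^ k <= #|M|.
  by move: Ak; rewrite expnS; lia.
- have [s sN sk] := IH _ Nk; exists (x :: s); last by rewrite /= sk.
  have /andP[ch /allP sN'] := sN; rewrite /chain /= ch xA !andbT.
  by apply/andP; split; apply/allP => y /sN'; rewrite inE => /andP[].
- have [s sN sk] := IH _ Mk; exists (rcons s x); last by rewrite size_rcons sk.
  have /andP[ch /allP sN'] := sN; rewrite /chain pairwise_rcons all_rcons ch xA !andbT.
  by apply/andP; split; apply/allP => y /sN'; rewrite inE => /andP[].
Qed.

End Tournament.

(** * Sparse pairs and smooth layers *)

Section FiniteSets.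
Variable T : finType.
Implicit Types (A B W : {set T}) (r : rel T).

Lemma subset_of_card k A : k <= #|A| -> exists2 B : {set T}, B \subset A & #|B| = k.
Proof.
move=> kA; exists [set x in take k (enum A)].
  by apply/subsetP => x; rewrite inE => /mem_take; rewrite mem_enum.
by rewrite cardsE (card_uniqP (take_uniq k (enum_uniq _))) size_takel -?cardE.
Qed.

Lemma disjoint_parts (I : eqType) (s : seq I) k W :
    uniq s -> size s * k <= #|W| ->
  exists V : I -> {set T}, {in s, forall u, V u \subset W /\ #|V u| = k} /\
    {in s &, forall u v, u != v -> [disjoint V u & V v]}.
Proof.
elim: s W => [|v s IH] W /=; first by exists (fun=> set0).
case/andP => vs us sW.
have [A AW Ak] : exists2 A : {set T}, A \subset W & #|A| = k.
  by apply: subset_of_card; lia.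
have [|V [VW Vd]] := IH (W :\: A) us.
  by rewrite cardsD (setIidPr AW) Ak; lia.
have V_A u : u \in s -> [disjoint A & V u].
  move=> /VW[+ _]; rewrite subsetD => /andP[_]; by rewrite disjoint_sym.
exists (fun u => if u == v then A else V u); split.
  move=> u; rewrite inE; case: eqVneq => //= _ us'.
  by have [VWu ->] := VW u us'; split=> //; apply: subset_trans VWu (subsetDl _ _).
move=> u w; rewrite !inE.
case: (eqVneq u v) => [->|uv] /=; case: (eqVneq w v) => [->|wv] //=.
- by move=> _ ws _; apply: V_A.
- by move=> us' _ _; rewrite disjoint_sym; apply: V_A.
- exact: Vd.
Qed.

Lemma card_has (I : eqType) (s : seq I) (P : I -> pred T) k A :
    {in s, forall i, #|[set x in A | P i x]| <= k} ->
  #|[set x in A | has (P^~ x) s]| <= size s * k.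
Proof.
elim: s => [|i s IH] Pk /=.
  by rewrite mul0n leqn0 cards_eq0; apply/eqP/setP => x; rewrite !inE andbF.
have -> : [set x in A | P i x || has (P^~ x) s] =
    [set x in A | P i x] :|: [set x in A | has (P^~ x) s].
  by apply/setP => x; rewrite !inE andb_orr.
rewrite mulSn; apply: leq_trans (leq_card_setU _ _) _.
rewrite leq_add ?Pk ?mem_head ?IH // => j js.
by apply: Pk; rewrite inE js orbT.
Qed.

Definition degree r B x := #|[set y in B | r x y]|.
Definition pairs r A B := \sum_(x in A) degree r B x.

Lemma pairs_swap r A B : pairs r A B = pairs (fun y x => r x y) B A.
Proof.
rewrite /pairs /degree.
under eq_bigr do rewrite -sum1_card.
under [RHS]eq_bigr do rewrite -sum1_card.
rewrite (exchange_big_dep (mem B)) /=; last by move=> x y _; rewrite inE => /andP[].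
by apply: eq_bigr => y yB; apply: eq_bigl => x; rewrite !inE yB.
Qed.

Lemma degree_sub r B B' x : B' \subset B -> degree r B' x <= degree r B x.
Proof.
move=> /subsetP BB; apply/subset_leq_card/subsetP => y.
by rewrite !inE => /andP[/BB-> ->].
Qed.

Lemma pairs_sub r A A' B B' :
  A' \subset A -> B' \subset B -> pairs r A' B' <= pairs r A B.
Proof.
move=> /subsetP AA BB; rewrite /pairs.
rewrite big_mkcond [leqRHS]big_mkcond /=; apply: leq_sum => x _.
case: ifP => // /AA ->; exact: degree_sub.
Qed.

(** Markov's inequality: if the pairs have density at most [1 / (k * p)], at most a fraction [1 / k]
    of [A] has relative degree above [1 / p]. *)
Lemma high_degrees r k p A B :
    k * p * pairs r A B <= #|A| * #|B| -> 0 < #|B| ->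
  k * #|[set x in A | #|B| < p * degree r B x]| <= #|A|.
Proof.
move=> kp B0; set S := [set x in A | _].
have : #|S| * #|B| <= p * pairs r A B.
  rewrite -sum_nat_const /pairs big_distrr /=.
  rewrite big_mkcond [leqRHS]big_mkcond /=; apply: leq_sum => x _.
  by rewrite inE; case: (x \in A) => //=; case: ifP => // /ltnW.
by nia.
Qed.

End FiniteSets.

(** * Sparse pairs and their iteration *)

Definition nonarc (T : tournament) : rel T := fun x y => ~~ arc x y.

Definition sparse (T : tournament) q (A B : {set T}) :=
  q * pairs (@nonarc T) A B <= #|A| * #|B|.

Lemma sparse_sub (T : tournament) q c (A B A' B' : {set T}) :
    0 < c -> sparse (q * (c * c)) A B -> A' \subset A -> B' \subset B ->
  #|A| <= c * #|A'| -> #|B| <= c * #|B'| -> sparse q A' B'.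
Proof.
rewrite /sparse => c0 AB AA BB Ac Bc.
have := pairs_sub (@nonarc T) AA BB.
set e := pairs _ A' B'; set e' := pairs _ A B in AB *; move=> ee.
rewrite -(@leq_pmul2l (c * c)) ?muln_gt0 ?c0 //.
apply: leq_trans (_ : q * (c * c) * e' <= _).
  by rewrite mulnA [c * c * q]mulnC leq_mul2l ee orbT.
by apply: leq_trans AB _; rewrite mulnACA leq_mul.
Qed.

(* Either the vertices of H are embedded one by one, the candidate sets of the
   remaining ones shrinking by a factor q each time, or the vertices which would
   make a candidate set shrink more span a sparse pair with it. *)
Lemma greedy_embedding (H T : tournament) (x0 : T) q s (W : {set T})
    (vs : seq H) (V : H -> {set T}) :
    0 < q -> 0 < s -> uniq vs ->
    {in vs, forall v, V v \subset W} ->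
    {in vs, forall v, size vs * q ^ size vs * s <= #|V v|} ->
    {in vs &, forall u v, u != v -> [disjoint V u & V v]} ->
  (exists2 f : H -> T, {in vs, forall u, f u \in V u} &
     {in vs &, forall u v, arc u v -> arc (f u) (f v)}) \/
  (exists A B : {set T}, [/\ A \subset W /\ B \subset W, [disjoint A & B],
     s <= #|A|, s <= #|B| & sparse q A B]).
Proof.
move=> q0 s0; elim: vs V => [|v vs IH] V /=; first by left; exists (fun=> x0).
case/andP => v_vs u_vs VW Vs Vd.
(* [r u] is the relation that the image of [v] must have to that of [u]. A vertex is bad for [u] if
   choosing it for [v] leaves less than a fraction [1 / q] of [V u]. *)
pose r u : rel T := fun x y => if arc v u then arc x y else arc y x.
pose bad u := [set x in V v | q * degree (r u) (V u) x < #|V u|].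
have vsS u : u \in vs -> u \in v :: vs by rewrite inE orbC => ->.
have sV u : u \in v :: vs -> s <= #|V u|.
  move=> /Vs; apply: leq_trans.
  by apply: leq_pmull; rewrite muln_gt0 expn_gt0 q0.
have [/hasP[u uvs us]|] := boolP (has (fun u => s <= #|bad u|) vs).
  right; have bad_V : bad u \subset V v.
    by apply/subsetP => x; rewrite inE => /andP[].
  have dis : [disjoint V u & bad u].
    rewrite disjoint_sym; apply: disjointWl bad_V _.
    by apply: Vd (mem_head _ _) (vsS _ uvs) _; apply: contraNneq v_vs => ->.
  have neq x y : x \in bad u -> y \in V u -> y != x.
    by move=> xb yV; apply: contraTneq xb => <-; rewrite (disjointFr dis).
  have few x : x \in bad u -> q * degree (r u) (V u) x <= #|V u|.
    by rewrite inE => /andP[_ /ltnW].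
  have bW : bad u \subset W by apply: subset_trans bad_V (VW _ (mem_head _ _)).
  have uW := VW _ (vsS _ uvs).
  have few_pairs (r' : rel T) : (forall x y, x \in bad u -> y \in V u -> r' x y -> r u x y) ->
      q * pairs r' (bad u) (V u) <= #|bad u| * #|V u|.
    move=> r'r; rewrite /pairs big_distrr /= -sum_nat_const.
    apply: leq_sum => x xb; apply: leq_trans (few x xb).
    rewrite leq_mul2l; apply/orP; right; apply/subset_leq_card/subsetP => y.
    by rewrite !inE => /andP[yV /(r'r _ _ xb yV) ->]; rewrite yV.
  (* The relation [r u] is rare from [bad u] to [V u]. The sparse pair must count non-arcs, so its
     two members are ordered against the arc between [v] and [u]. *)
  case E: (arc v u).
    exists (V u), (bad u); split=> //; first by apply: sV; apply: vsS.
    rewrite /sparse pairs_swap mulnC [leqRHS]mulnC mulnC; apply: few_pairs => x y xb yV.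
    by rewrite /r E; apply: arc_flip; apply: neq.
  exists (bad u), (V u); split=> //; [by rewrite disjoint_sym|by apply: sV; apply: vsS|].
  apply: few_pairs => x y xb yV; rewrite /r E; apply: arc_flip.
  by rewrite eq_sym; apply: neq.
move=> /hasPn few.
have [x xV xgood] : exists2 x, x \in V v &
    ~~ has (fun u => q * degree (r u) (V u) x < #|V u|) vs.
  have le : #|[set x in V v | has (fun u => q * degree (r u) (V u) x < #|V u|) vs]|
      <= size vs * s.
    apply: (@card_has T H vs (fun u x => q * degree (r u) (V u) x < #|V u|)).
    by move=> u /few; rewrite -ltnNge => /ltnW.
  have lt : size vs * s < #|V v|.
    apply: leq_trans (Vs _ (mem_head _ _)).
    rewrite ltn_mul2r s0 /=; apply: leq_pmulr.
    by rewrite expn_gt0 q0.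
  have /subsetPn[x xV xn] : ~~ (V v \subset
      [set x in V v | has (fun u => q * degree (r u) (V u) x < #|V u|) vs]).
    by apply: contraL lt => /subset_leq_card; rewrite -leqNgt => /leq_trans ->.
  by exists x => //; move: xn; rewrite inE xV.
pose V' u := [set y in V u | r u x y].
have V'V u : V' u \subset V u by apply/subsetP => y; rewrite inE => /andP[].
have [|||[f fV farc]|] := IH V' u_vs.
- by move=> u uvs; apply: subset_trans (V'V u) (VW _ (vsS _ uvs)).
- move=> u uvs; have := hasPn xgood u uvs; rewrite -leqNgt -[degree _ _ _]/(#|V' u|).
  move=> h; rewrite -(leq_pmul2l q0); apply: leq_trans h.
  apply: leq_trans (Vs _ (vsS _ uvs)); rewrite expnS; nia.
- move=> u w uvs wvs uw.
  exact: disjointW (V'V u) (V'V w) (Vd _ _ (vsS _ uvs) (vsS _ wvs) uw).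
- left; exists (fun u => if u == v then x else f u).
    move=> u; rewrite inE; case: eqVneq => [->|_ /= /fV] //.
    exact/subsetP/V'V.
  move=> u w; rewrite !inE.
  case: (eqVneq u v) => [->|uv] /=; case: (eqVneq w v) => [->|wv] //=.
  + by rewrite arc_irr.
  + by move=> _ /fV; rewrite inE /r => /andP[_ +] vw; rewrite vw.
  + move=> /fV + _ uv'; rewrite inE /r => /andP[_].
    by rewrite (negbTE (arc_asym uv')).
  + exact: farc.
- by right.
Qed.

Lemma sparse_pair (H : tournament) q : 0 < q -> exists2 C, 0 < C &
  forall T : tournament, ~ embeds H T -> forall W : {set T},
  exists A B : {set T}, [/\ A \subset W /\ B \subset W, [disjoint A & B],
    #|W| %/ C <= #|A|, #|W| %/ C <= #|B| & sparse q A B].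
Proof.
(* This [C] leaves room in [W] for [h] disjoint candidate sets of [h * q ^ h * s] vertices each. *)
move=> q0; pose h := #|H|; pose C := (h * (h * q ^ h)).+1.
exists C => // T HT W; pose s := #|W| %/ C.
case: (posnP s) => [s0|s0].
  exists set0, set0; rewrite !sub0set -/s s0 disjoints_subset sub0set; split=> //.
  by rewrite /sparse /pairs big_set0 muln0.
have [x0 _] : exists x0, x0 \in W.
  by apply/card_gt0P; move: s0; rewrite divn_gt0 //; apply: leq_trans.
have eh : size (enum H) = h by rewrite -cardE.
have [|V [Vs Vd]] := @disjoint_parts T H (enum H) (h * q ^ h * s) W (enum_uniq _).
  rewrite eh; apply: leq_trans (leq_trunc_div #|W| C); rewrite -/s /C; nia.
have [|||[f fV farc]|//] := @greedy_embedding H T x0 q s W (enum H) V q0 s0 (enum_uniq _).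
- by move=> v /Vs[].
- by move=> v /Vs[_ ->]; rewrite eh.
- exact: Vd.
by case: HT; exists f => u v; apply: farc; rewrite mem_enum.
Qed.

(** Take a sparse pair and recurse inside both of its members. The layers found are smaller than
    these by a factor of at most [C1], so the pair is requested with [q * (C1 * C1)] in place of
    [q]. *)
Lemma layers (H : tournament) d q : 0 < q -> exists2 C, 0 < C &
  forall T : tournament, ~ embeds H T -> forall W : {set T}, C <= #|W| ->
  exists A : nat -> {set T},
    (forall i, i < 2 ^ d -> A i \subset W /\ #|W| <= C * #|A i|) /\
    (forall i j, i < j < 2 ^ d -> [disjoint A i & A j] /\ sparse q (A i) (A j)).
Proof.
move=> q0; elim: d => [|d [C1 C10 IH]].
  exists 1 => // T _ W _; exists (fun=> W); split=> [i _|i j]; first by rewrite mul1n.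
  by rewrite expn0 => /andP[]; case: j.
have q'0 : 0 < q * (C1 * C1) by rewrite !muln_gt0 q0 C10.
have [C0 C00 HC0] := sparse_pair H q'0.
exists (2 * C0 * C1); first by rewrite !muln_gt0 C00 C10.
move=> T HT W CW; have [X [Y [[XW YW] XY sX sY spXY]]] := HC0 T HT W.
set s := #|W| %/ C0 in sX sY.
have Ws : #|W| <= 2 * C0 * s /\ C1 <= s.
  have := ltn_ceil #|W| C00; rewrite -/s => W1.
  have : 2 * C1 <= s by rewrite leq_divRL //; lia.
  by nia.
have [C1X C1Y] : C1 <= #|X| /\ C1 <= #|Y| by lia.
have [A [AX Asp]] := IH T HT X C1X; have [B [BY Bsp]] := IH T HT Y C1Y.
have W_le Z U : s <= #|Z| -> #|Z| <= C1 * #|U| -> #|W| <= 2 * C0 * C1 * #|U|.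
  move=> sZ ZU; apply: leq_trans Ws.1 _; rewrite -[leqRHS]mulnA leq_mul2l.
  by rewrite (leq_trans sZ ZU) orbT.
exists (fun i => if i < 2 ^ d then A i else B (i - 2 ^ d)).
have sub i : i < 2 ^ d.+1 -> 2 ^ d <= i -> i - 2 ^ d < 2 ^ d by rewrite expnS; lia.
split=> [i i2|i j /andP[ij j2]].
  case: ltnP => [/AX[AiX XAi]|/(sub _ i2) /BY[BiY YBi]].
    by split; [apply: subset_trans XW|apply: W_le XAi].
  by split; [apply: subset_trans YW|apply: W_le YBi].
case: (ltnP j) => [jd|/[dup] dj /(sub _ j2) jd].
  by rewrite (ltn_trans ij jd); apply: Asp; rewrite ij.
case: ltnP => [id|di].
  have [[AiX XAi] [BjY YBj]] := (AX _ id, BY _ jd).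
  by split; [apply: disjointW XY|apply: sparse_sub spXY _ _ _ _].
by apply: Bsp; rewrite jd; lia.
Qed.

(** Average sparsity becomes a bound at every vertex once the vertices with too many backward
    neighbours in some other layer are deleted. *)
Lemma smooth_layers (H : tournament) n p : 0 < p -> exists2 C, 0 < C &
  forall T : tournament, ~ embeds H T -> forall W : {set T}, C <= #|W| ->
  exists A : nat -> {set T},
    (forall i, i < n -> A i \subset W /\ #|W| <= C * #|A i|) /\
    (forall i j, i < j < n -> [/\ [disjoint A i & A j],
       {in A i, forall x, p * degree (@nonarc T) (A j) x <= #|A j|} &
       {in A j, forall y, p * degree (fun v u => nonarc u v) (A i) y <= #|A i|}]).
Proof.
(* Each of at most [n] layers causes the loss of a fraction [1 / k], so less than half of a layer is
   deleted. The factor 2 in [2 * p] makes up for the halving of the layer in which degrees are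
   counted. *)
move=> p0; pose k := 2 * n.+1; pose q := k * (2 * p).
have q0 : 0 < q by rewrite !muln_gt0 p0.
have [C C0 HC] := layers H n q0.
exists (2 * C); first by rewrite muln_gt0 C0.
move=> T HT W CW; have [|A [AW Asp]] := HC T HT W; first by lia.
have n2 i : i < n -> i < 2 ^ n by move=> /ltn_trans; apply; apply: ltn_expl.
pose r i j : rel T := if i < j then @nonarc T else fun y x => nonarc x y.
pose bad i j x := (i != j) && (#|A j| < 2 * p * degree (r i j) (A j) x).
pose A' i := [set x in A i | ~~ has (fun j => bad i j x) (iota 0 n)].
have A'A i : A' i \subset A i by apply/subsetP => x; rewrite inE => /andP[].
have A0 i : i < n -> 0 < #|A i|.
  by move=> /n2 /AW[_]; case: #|A i| => //; rewrite muln0; lia.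
have few i j : i < n -> j < n -> i != j ->
    q * pairs (r i j) (A i) (A j) <= #|A i| * #|A j|.
  move=> i_n j_n; rewrite neq_ltn => /orP[ij|ji]; rewrite /r.
    by rewrite ij; have [] := Asp i j; rewrite ?ij ?n2.
  rewrite ltnNge (ltnW ji) /= mulnC [leqRHS]mulnC mulnC pairs_swap.
  by have [] := Asp j i; rewrite ?ji ?n2.
have halve i : i < n -> #|A i| <= 2 * #|A' i|.
  move=> i_n.
  have : #|[set x in A i | has (fun j => bad i j x) (iota 0 n)]| <= n * (#|A i| %/ k).
    rewrite -{2}(size_iota 0 n); apply: (@card_has T _ _ (bad i)) => j.
    rewrite mem_iota /= add0n => j_n; rewrite leq_divRL // mulnC.
    rewrite /bad; have [->|ij] := eqVneq i j.
      rewrite (_ : [set x in A j | _] = set0) ?cards0 ?muln0 //.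
      by apply/setP => x; rewrite !inE ?eqxx ?andbF.
    have := @high_degrees T (r i j) k (2 * p) (A i) (A j) (few _ _ i_n j_n ij) (A0 _ j_n).
    by congr (_ * _ <= _); apply: eq_card => x; rewrite !inE ij.
  have : #|A i| = #|[set x in A i | has (fun j => bad i j x) (iota 0 n)]| + #|A' i|.
    rewrite -(cardsID [set x | has (fun j => bad i j x) (iota 0 n)] (A i)).
    by congr (_ + _); apply: eq_card => x; rewrite !inE // andbC.
  by have := leq_trunc_div #|A i| k; rewrite /k; nia.
have good i j x : i < n -> j < n -> i != j -> x \in A' i ->
    p * degree (r i j) (A' j) x <= #|A' j|.
  move=> i_n j_n ij; rewrite inE => /andP[_ /hasPn /(_ j)].
  rewrite mem_iota /= add0n j_n /bad ij /= => /(_ isT); rewrite -leqNgt => h.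
  have := degree_sub (r i j) x (A'A j); have := halve _ j_n.
  by nia.
exists A'; split=> [i i_n|i j /andP[ij j_n]].
  have [AiW WAi] := AW _ (n2 _ i_n); split; first exact: subset_trans (A'A i) AiW.
  by have := halve _ i_n; nia.
have i_n := ltn_trans ij j_n.
have [dis _] : [disjoint A i & A j] /\ sparse q (A i) (A j) by apply: Asp; rewrite ij n2.
split.
- exact: disjointW (A'A i) (A'A j) dis.
- by move=> x xA; have := good i j x i_n j_n; rewrite /r ij neq_ltn ij => ->.
- move=> y yA; have := good j i y j_n i_n.
  by rewrite /r ltnNge (ltnW ij) neq_ltn ij orbT => ->.
Qed.

(** * Embedding a C5-chain *)

Lemma product_arcl (H1 H2 : tournament) f1 f2 f1_inj f2_inj dis (x y : H1) :
  @arc (@product H1 H2 f1 f2 f1_inj f2_inj dis) (inl x) (inl y) -> arc x y.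
Proof.
rewrite /= /from_backward_arc /= /backward.
case: ltngtP => //= [xy|_ /andP[]//]; rewrite andbT => yx.
have := @arc_total H1 x y; rewrite (negbTE yx) addbF; apply.
by apply: contraTneq xy => ->; rewrite ltnn.
Qed.

Lemma product_arcr (H1 H2 : tournament) f1 f2 f1_inj f2_inj dis (x y : H2) :
  @arc (@product H1 H2 f1 f2 f1_inj f2_inj dis) (inr x) (inr y) -> arc x y.
Proof.
rewrite /= /from_backward_arc /= /backward.
case: ltngtP => //= [xy|_ /andP[]//]; rewrite andbT => yx.
have := @arc_total H2 x y; rewrite (negbTE yx) addbF; apply.
by apply: contraTneq xy => ->; rewrite ltnn.
Qed.

(* Podd t is transitive: its order is p_2, p_1, p_4, p_3, ... *)
Definition path_rank k := if odd k then k else k.+2.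

Lemma Podd_rank t (x y : Podd t) :
  arc x y -> path_rank (x : 'I_(2 * t + 1)) < path_rank (y : 'I_(2 * t + 1)).
Proof.
rewrite /= /from_backward_arc /path_rank /P_backward.
case: ltngtP => // [xy|yx /=].
- apply: contraR => ranks; apply/hasP; exists (x : 'I_(2 * t + 1))./2.+1.
    by rewrite mem_iota; have := ltn_ord y; lia.
  by move: ranks; case: ifP; case: ifP; lia.
- by case/hasP => i _ /andP[/eqP xi /eqP yi]; case: ifP; case: ifP; lia.
Qed.

Lemma path_rank_lt t k : k < 2 * t + 1 -> path_rank k < 2 * t + 3.
Proof. by rewrite /path_rank; case: ifP; lia. Qed.

Lemma path_rank_gt2 k : 2 < path_rank k.+2.
Proof. by rewrite /path_rank; case: ifP; case: k. Qed.

(** The only interleaving of the two factors is that [p_1], at position 6, precedes [h_6], at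
    position 7. *)
Lemma rho2_lt_rho1 t (x : Podd t) (y : Hl) : rho2 x < rho1 y ->
  (x : 'I_(2 * t + 1)) = 0 :> nat /\ (y : 'I_6) = 5 :> nat.
Proof.
rewrite /rho2 /rho1; have := ltn_ord y.
by case: ifP => x_odd; case: ifP => y5 y6 lt; move: x_odd y5 y6 lt; lia.
Qed.

(** The 28 arcs orient all pairs among the eight vertices. The remaining [p]'s go to the entries of
    [w] given by [path_rank], which is at most [2 * t + 2]; hence the size asked of [w]. *)
Lemma C5_chain_embeds (t : nat) (T : tournament) (h1 h2 h3 h4 h5 h6 p1 p2 : T)
    (w : seq T) :
    all (fun e => arc e.1 e.2)
      [:: (h1, h2); (h1, h3); (h2, h3); (h2, h4); (h3, h4); (h3, h5); (h4, h1);
          (h4, h5); (h5, h1); (h5, h2); (h1, h6); (h2, h6); (h4, h6); (h5, h6);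
          (h6, h3); (h1, p1); (h2, p1); (h3, p1); (h4, p1); (h5, p1); (p1, h6);
          (h1, p2); (h2, p2); (h3, p2); (h4, p2); (h5, p2); (h6, p2); (p2, p1)] ->
    pairwise (@arc T) w -> 2 * t + 3 <= size w ->
    allrel (@arc T) [:: h1; h2; h3; h4; h5; h6; p1; p2] w ->
  embeds (C5_chain_of t) T.
Proof.
rewrite /=; do 28!case/andP => ?; move=> _ wch sw vw.
have {}vw z i : z \in [:: h1; h2; h3; h4; h5; h6; p1; p2] -> i < 2 * t + 3 ->
    arc z (nth h1 w i).
  move=> zv ti; apply: (allrelP vw) => //; apply: mem_nth; exact: leq_trans sw.
pose h i := nth h1 [:: h1; h2; h3; h4; h5; h6] i.
have h_in i : h i \in [:: h1; h2; h3; h4; h5; h6; p1; p2].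
  by rewrite /h; case: i => [|[|[|[|[|[|i]]]]]] /=; rewrite ?nth_nil !inE ?eqxx ?orbT.
pose p k := if k == 0 then p1 else if k == 1 then p2 else nth h1 w (path_rank k).
have rank_lt (k : 'I_(2 * t + 1)) : path_rank k < 2 * t + 3.
  exact/path_rank_lt/ltn_ord.
exists (fun u : Hl + Podd t => match u with
  inl x => h (x : 'I_6) | inr k => p (k : 'I_(2 * t + 1)) end).
case=> [x|x] [y|y].
- move/product_arcl.
  by case: x => [[|[|[|[|[|[|]]]]]] ?] //; case: y => [[|[|[|[|[|[|]]]]]] ?].
- move=> xy; rewrite /p; case: ifP => [y0|_].
    move: xy; rewrite /= /from_backward_arc /= /rho2 (eqP y0) /=.
    by case: x => [[|[|[|[|[|[|]]]]]] ?].
  case: ifP => _; first by case: x xy => [[|[|[|[|[|[|]]]]]] ?].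
  exact: vw.
- rewrite /= /from_backward_arc /= andbF; case: ifP => // yx _.
  have [x0 y5] := rho2_lt_rho1 yx.
  have -> : p (x : 'I_(2 * t + 1)) = p1 by rewrite /p x0.
  by have -> : h (y : 'I_6) = h6 by rewrite /h y5.
- move/product_arcr/Podd_rank; rewrite /p.
  case: x => -[|[|x]] /= x_t; case: y => -[|[|y]] /= y_t //=.
  + by move=> _; apply: vw; rewrite ?path_rank_lt // !inE eqxx ?orbT.
  + by move=> _; apply: vw; rewrite ?path_rank_lt // !inE eqxx ?orbT.
  + by rewrite ltnNge ltnW // path_rank_gt2.
  + by rewrite ltnNge ltnW // (ltn_trans _ (path_rank_gt2 x)).
  + by move=> xy; apply: (pairwiseP h1 wch) => //; apply: leq_trans sw; apply: path_rank_lt.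
Qed.

Lemma count_card (T : finType) (s : seq T) (a : pred T) :
  uniq s -> count a s = #|[set x in [set y in s] | a x]|.
Proof.
move=> us; rewrite -size_filter -(card_uniqP (filter_uniq a us)).
by apply: eq_card => x; rewrite !inE mem_filter andbC.
Qed.

(** About a third of [s] lies in [s'], and each condition fails on at most a sixteenth of [s]. What
    is left is an eighth as soon as [(size s - 2) / 3] is at least [size s / 4], that is, from size
    8 on. *)
Lemma size_filter_and (T : eqType) (s s' : seq T) (a b : rel T) (x y : T) :
    8 <= size s -> size s <= 3 * size s' + 2 ->
    16 * count (fun m => ~~ a x m) s <= size s ->
    16 * count (fun m => ~~ b m y) s <= size s -> subseq s' s ->
  size s <= 8 * size [seq m <- s' | a x m && b m y].
Proof.
move=> s8 s's a_few b_few sub.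
have le c : count c s' <= count c s.
  exact: leq_count_subseq.
have := count_predC (fun m => a x m && b m y) s'; rewrite -size_filter.
have := count_predUI (fun m => ~~ a x m) (fun m => ~~ b m y) s'.
have -> : count (predC (fun m => a x m && b m y)) s' =
    count (predU (fun m => ~~ a x m) (fun m => ~~ b m y)) s'.
  by apply: eq_count => m /=; rewrite negb_and.
have := le (fun m => ~~ a x m); have := le (fun m => ~~ b m y).
lia.
Qed.

(** * Finding a C5-chain in ten smooth layers *)

Section SmoothLayers.

Variables (T : tournament) (W : {set T}) (A : nat -> {set T}) (n C L : nat).

Definition big (B : {set T}) := (B \subset W) && (#|W| <= C * #|B|).

(** The factor 8 makes every eighth of a layer still count as [big]. *)
Hypothesis A_big : forall i, i < n -> A i \subset W /\ 8 * #|W| <= C * #|A i|.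
Hypothesis A_smooth : forall i j, i < j < n -> [/\ [disjoint A i & A j],
  {in A i, forall x, 64 * degree (@nonarc T) (A j) x <= #|A j|} &
  {in A j, forall y, 64 * degree (fun v u => nonarc u v) (A i) y <= #|A i|}].

Lemma layer_arc i j x y : i < j < n -> x \in A i -> y \in A j ->
  ~~ arc x y -> arc y x.
Proof.
move=> /A_smooth[dis _ _] xi yj; apply: arc_flip.
by apply: contraTneq xi => ->; rewrite (disjointFl dis).
Qed.

Lemma big_sub i (B : {set T}) : i < n -> B \subset A i -> #|A i| <= 8 * #|B| -> big B.
Proof.
move=> /A_big[AW WA] BA AB; rewrite /big (subset_trans BA AW) /=.
by move: WA AB; set w := #|W|; set a := #|A i|; set b := #|B|; nia.
Qed.

(* [e.1] is the index of the layer of the vertex [e.2]. *)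
Definition forward_to j (e : nat * T) v := if e.1 < j then arc e.2 v else arc v e.2.

Definition common j es := [set v in A j | all (fun e => forward_to j e v) es].

Definition in_layers j es :=
  all (fun e : nat * T => [&& e.1 < n, e.1 != j & e.2 \in A e.1]) es.

(** Each of at most eight vertices excludes at most [1 / 64] of the layer, hence [1 / 8] in all. *)
Lemma common_large j es : in_layers j es -> j < n -> size es <= 8 ->
  #|A j| <= 2 * #|common j es|.
Proof.
move=> /allP es_j j_n es8.
have : #|[set v in A j | has (fun e => ~~ forward_to j e v) es]|
    <= size es * (#|A j| %/ 64).
  apply: (@card_has T _ _ (fun e v => ~~ forward_to j e v)) => -[i z].
  case/es_j/and3P => /= i_n; rewrite neq_ltn => ij z_i.
  rewrite leq_divRL // mulnC /forward_to /=; case/orP: ij => [ij|ji].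
    have [|_ /(_ z z_i) + _] := @A_smooth i j; first by rewrite ij.
    by rewrite ij.
  have [|_ _ /(_ z z_i)] := @A_smooth j i; first by rewrite ji.
  by rewrite ltnNge (ltnW ji).
rewrite -(cardsID [set v | has (fun e => ~~ forward_to j e v) es] (A j)).
have -> : A j :\: [set v | has (fun e => ~~ forward_to j e v) es] = common j es.
  apply/setP => v; rewrite !inE andbC; congr (_ && _).
  by rewrite -all_predC; apply: eq_all => e /=; rewrite negbK.
rewrite -setIdE; set a := #|_|; set b := #|_|.
by have := leq_trunc_div (a + b) 64; nia.
Qed.

Lemma common_big j es : in_layers j es -> j < n -> size es <= 8 ->
  big (common j es).
Proof.
move=> es_j j_n es8; apply: (big_sub j_n).
  by apply/subsetP => v; rewrite inE => /andP[].
by have := common_large es_j j_n es8; lia.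
Qed.

(** These express near-maximality: every big set has a chain of length [L], and completeness would
    let it be prolonged by another chain of length at least [L / 8]. *)
Hypothesis no_big_pair : forall B D, big B -> big D ->
  exists x y, [/\ x \in B, y \in D & ~~ arc x y].
Hypothesis no_big_chain : forall B s, big B -> chain W s -> L <= 8 * size s ->
  exists x y, [/\ x \in B, y \in s & ~~ arc x y].
Hypothesis no_chain_big : forall B s, big B -> chain W s -> L <= 8 * size s ->
  exists x y, [/\ x \in s, y \in B & ~~ arc x y].
Hypothesis has_chain : forall B, big B -> exists2 s, chain B s & L <= size s.

(** As [64 = 4 * 16], averaging leaves at most a quarter of the layer with more than [size s / 16]
    neighbours in [s]. At most another eighth has no neighbour in [s'], since a larger such set
    would be big. *)
Lemma back_neighbours i (r : rel T) (s s' : seq T) :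
    i < n -> uniq s -> 0 < size s ->
    {in s, forall m, 64 * degree (fun m x => r x m) (A i) m <= #|A i|} ->
    (forall B, big B -> exists x y, [/\ x \in B, y \in s' & r x y]) ->
  exists2 B, big B & {in B, forall x, [/\ x \in A i, 16 * count (r x) s <= size s &
    exists2 y, y \in s' & r x y]}.
Proof.
move=> i_n us s0 few s'_back.
have sE : #|[set m in s]| = size s by rewrite cardsE; apply/card_uniqP.
have : 4 * #|[set x in A i | size s < 16 * count (r x) s]| <= #|A i|.
  have := @high_degrees T r 4 16 (A i) [set m in s]; rewrite sE s0 => H.
  apply: leq_trans (H _ isT); last first.
    rewrite pairs_swap [leqRHS]mulnC -sE -sum_nat_const /pairs big_distrr /=.
    by apply: leq_sum => m; rewrite inE => /few.
  rewrite leq_mul2l /=; apply/subset_leq_card/subsetP => x.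
  by rewrite !inE count_card.
set X := [set x in A i | _] => X4.
pose Y := A i :\: X; pose B := [set x in Y | has (r x) s']; pose D := Y :\: B.
have YA : #|A i| = #|X| + #|Y|.
  by rewrite -(cardsID X (A i)) (setIidPr _) //; apply/subsetP => x; rewrite inE => /andP[].
have YB : #|Y| = #|B| + #|D|.
  by rewrite -(cardsID B Y) (setIidPr _) //; apply/subsetP => x; rewrite inE => /andP[].
have [AW WA] := A_big i_n.
have YsA : Y \subset A i := subsetDl _ _.
have BsY : B \subset Y by apply/subsetP => x; rewrite inE => /andP[].
have D8 : 8 * #|D| <= #|A i|.
  rewrite leqNgt; apply/negP => D8.
  have /s'_back[x [y [xD ys xy]]] : big D.
    apply: (big_sub i_n); last exact: ltnW.
    exact: subset_trans (subsetDl _ _) YsA.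
  have [xY /negP[]] : x \in Y /\ x \notin B by apply/andP; rewrite andbC -in_setD.
  by rewrite inE xY; apply/hasP; exists y.
exists B.
  by apply: (big_sub i_n); [apply: subset_trans YsA|lia].
move=> x; rewrite !inE => /andP[/andP[+ xA] /hasP xs].
by rewrite xA -leqNgt => few_x; split.
Qed.

(** Layers 0, 2 and 5 hold [x], the chain and [y], and layer 9 the tail of the path. The other
    layers are used according to where a new vertex must lie for its remaining edges to go
    forward. *)
Lemma layers_C5_chain t : n = 10 -> 8 <= L -> 2 * t + 3 <= L ->
  embeds (C5_chain_of t) T.
Proof.
move=> n10 L8 tL; have n9 : 9 < n by rewrite n10.
have lt_n i : i < 10 -> i < n by move=> /leq_trans; apply.
have A_in i : i < 10 -> big (A i).
  by move=> /lt_n i_n; apply: (big_sub i_n) => //; apply: leq_pmull.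
have back i j x y : i < j -> j < 10 -> x \in A i -> y \in A j -> ~~ arc x y -> arc y x.
  by move=> ij j10; apply: layer_arc; rewrite ij lt_n.
have tail zs : size zs <= 8 -> in_layers 9 zs ->
    exists w, [/\ pairwise (@arc T) w, 2 * t + 3 <= size w &
      allrel (@arc T) (map snd zs) w].
  move=> zs8 zs_in; have [w /andP[w_ch /allP w_in] Lw] := has_chain (common_big zs_in n9 zs8).
  exists w; split=> //; first exact: leq_trans Lw.
  apply/allrelP => _ v /mapP[e e_zs ->] /w_in; rewrite inE => /andP[_ /allP /(_ _ e_zs)].
  by have /and3P[e_n e9 _] := allP zs_in _ e_zs; rewrite /forward_to; case: ltnP => //; lia.
have [s [s_ch sL]] : exists s, chain (A 2) s /\ size s = L.
  have [s s_ch Ls] := has_chain (A_in 2 isT).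
  exists (take L s); split; last by rewrite size_takel.
  by apply: chain_subseq s_ch; apply: take_subseq.
have us : uniq s by have := s_ch => /andP[/pairwise_uniq-> //] x; rewrite arc_irr.
(* With [L] at least 8, each third has at least [L / 8] vertices, as the hypotheses on chains
   require. *)
pose k := L %/ 3; have Lk : L = k * 3 + L %% 3 := divn_eq _ _; have L3 := ltn_pmod L (isT : 0 < 3).
pose M1 := take k s; pose M2 := take k (drop k s); pose M3 := drop k (drop k s).
have sE : s = M1 ++ (M2 ++ M3) by rewrite !cat_take_drop.
have chW : chain W s by apply: chain_sub s_ch; have [] := A_big (lt_n 2 isT).
have [ch1 ch2 ch3] : [/\ chain W M1, chain W M2 & chain W M3].
  split; apply: chain_subseq chW; first exact: take_subseq.
    by apply: (@subseq_trans _ (drop k s)); [apply: take_subseq|apply: drop_subseq].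
  by apply: (@subseq_trans _ (drop k s)); apply: drop_subseq.
have s1 : size M1 = k by rewrite size_takel // sL; lia.
have s2 : size M2 = k by rewrite size_takel // size_drop sL; lia.
have s3 : k <= size M3 by rewrite !size_drop sL; lia.
have [A1 A2 A3] : [/\ {subset M1 <= A 2}, {subset M2 <= A 2} & {subset M3 <= A 2}].
  have /andP[_ /allP s_A] := s_ch; split=> m mM; apply: s_A; rewrite sE !mem_cat mM ?orbT //.
have [M12 M13 M23] : [/\ {in M1 & M2, forall a b, arc a b},
    {in M1 & M3, forall a b, arc a b} & {in M2 & M3, forall a b, arc a b}].
  have : pairwise (@arc T) (M1 ++ (M2 ++ M3)) by rewrite -sE; case/andP: s_ch.
  rewrite pairwise_cat allrel_catr => /and3P[/andP[/allrelP r12 /allrelP r13] _].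
  by rewrite pairwise_cat => /and3P[/allrelP r23 _ _]; split=> a b; auto.
have [|||X bigX X_back] := @back_neighbours 0 (@nonarc T) s M3 (lt_n 0 isT) us.
- by rewrite sL; clear -L8; lia.
- have [|_ _ sm] := @A_smooth 0 2; first by rewrite lt_n.
  by move=> m ms; apply: sm; have /andP[_ /allP] := s_ch; apply.
- by move=> B /no_big_chain /(_ ch3); apply; clear -s3 Lk L8 L3; lia.
have [|||Y bigY Y_back] := @back_neighbours 5 (fun y m => nonarc m y) s M1 (lt_n 5 isT) us.
- by rewrite sL; clear -L8; lia.
- have [|_ sm _] := @A_smooth 2 5; first by rewrite lt_n.
  by move=> m ms; apply: sm; have /andP[_ /allP] := s_ch; apply.
- move=> B /no_chain_big /(_ ch1) []; first by clear -s1 Lk L8 L3; lia.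
  by move=> m [y [mM yB my]]; exists y, m.
have [x [y [xX yY nxy]]] := no_big_pair bigX bigY.
have [x0 x_few [m3 m3M nxm3]] := X_back x xX.
have [y5 y_few [m1 m1M nm1y]] := Y_back y yY.
have [m1_2 m3_2] := (A1 _ m1M, A3 _ m3M).
have yx := back 0 5 x y isT isT x0 y5 nxy.
have m3x := back 0 2 x m3 isT isT x0 m3_2 nxm3.
have ym1 := back 2 5 m1 y isT isT m1_2 y5 nm1y.
(* If x -> m1 and m3 -> y, then x, m1, x3, m3, y are h_1, ..., h_5 for every
   suitable x3 between m1 and m3.  Otherwise m1 or m3 is an m such that y -> m,
   m -> x and y -> x, and x, h_2, m, h_1, h_6, y, p_2, p_1 with x = h_5, m = h_4
   and y = h_3 is an ordering of the eight vertices whose only backward edges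
   are these three, (h_1, h_2) and (p_1, h_6). *)
have [/andP[xm1 m3y]|no_path] := boolP (arc x m1 && arc m3 y).
  pose M := [seq m <- M2 | arc x m && arc m y].
  have chM : chain W M by apply: chain_subseq ch2; apply: filter_subseq.
  have LM : L <= 8 * size M.
    have s8 : 8 <= size s by rewrite sL.
    rewrite -sL.
    apply: size_filter_and s8 _ x_few y_few _; first by rewrite s2 sL; clear -Lk L3; lia.
    by apply: (@subseq_trans _ (drop k s)); [apply: take_subseq|apply: drop_subseq].
  have zs7 : in_layers 7 [:: (0, x); (2, m1); (2, m3); (5, y)].
    by rewrite /in_layers /= !lt_n // x0 y5 m1_2 m3_2.
  (* The surviving middle part still has [L / 8] vertices, which yields the backward edge
     [(h_6, h_3)] with [h_3 = x3]. *)
  have [x3 [h6 [x3M h6A nx3h6]]] := no_chain_big (common_big zs7 (lt_n 7 isT) isT) chM LM.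
  move: h6A x3M; rewrite inE mem_filter /= /forward_to /= andbT.
  case/and5P => h6_7 x_h6 m1_h6 m3_h6 y_h6 /andP[/andP[x_x3 x3_y] x3M].
  have x3_2 := A2 _ x3M.
  have h6_x3 := back 2 7 x3 h6 isT isT x3_2 h6_7 nx3h6.
  pose zs := [:: (0, x); (2, m1); (2, x3); (2, m3); (5, y); (7, h6)].
  have zs8 : in_layers 8 zs.
    by rewrite /in_layers /zs /= !lt_n // x0 y5 h6_7 m1_2 x3_2 m3_2.
  have zs6 : in_layers 6 zs.
    by rewrite /in_layers /zs /= !lt_n // x0 y5 h6_7 m1_2 x3_2 m3_2.
  (* Layer 7 of [h6] lies between layers 6 and 8, so [p1] beats [h6] and [h6] beats [p2] by forward
     edges, while the edge from [p2] to [p1] is backward. *)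
  have [p1 [p2 [p1A p2A np1p2]]] :=
    no_big_pair (common_big zs6 (lt_n 6 isT) isT) (common_big zs8 (lt_n 8 isT) isT).
  move: p1A p2A; rewrite !inE /= /forward_to /= !andbT.
  case/andP => p1_6 /and5P[x_p1 m1_p1 x3_p1 m3_p1 /andP[y_p1 p1_h6]].
  case/andP => p2_8 /and5P[x_p2 m1_p2 x3_p2 m3_p2 /andP[y_p2 h6_p2]].
  have p2_p1 := back 6 8 p1 p2 isT isT p1_6 p2_8 np1p2.
  have [||w [w_ch w_size zw]] := tail
    [:: (0, x); (2, m1); (2, x3); (2, m3); (5, y); (7, h6); (6, p1); (8, p2)].
  - by [].
  - by rewrite /in_layers /= !lt_n // x0 y5 h6_7 p1_6 p2_8 m1_2 x3_2 m3_2.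
  apply: C5_chain_embeds w_ch w_size zw.
  by rewrite /= xm1 x_x3 m3x yx (M12 _ _ m1M x3M) (M13 _ _ m1M m3M) (M23 _ _ x3M m3M)
    ym1 x3_y m3y x_h6 m1_h6 m3_h6 y_h6
    h6_x3 x_p1 m1_p1 x3_p1 m3_p1 y_p1 p1_h6 x_p2 m1_p2 x3_p2 m3_p2 y_p2 h6_p2 p2_p1.
have [m [m2 mx ym]] : exists m, [/\ m \in A 2, arc m x & arc y m].
  move: no_path; rewrite negb_and => /orP[nxm1|nm3y].
    by exists m1; split=> //; apply: (back 0 2).
  by exists m3; split=> //; apply: (back 2 5).
have zs1 : in_layers 1 [:: (0, x); (2, m); (5, y)] by rewrite /in_layers /= !lt_n // x0 m2 y5.
have zs3 : in_layers 3 [:: (0, x); (2, m); (5, y)] by rewrite /in_layers /= !lt_n // x0 m2 y5.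
(* Layer 1 lies between [x] and [m], layer 3 between [m] and [y]; the edge from [h1] to [h2] is
   backward. *)
have [h2 [h1 [h2A h1A nh]]] :=
  no_big_pair (common_big zs1 (lt_n 1 isT) isT) (common_big zs3 (lt_n 3 isT) isT).
move: h2A h1A; rewrite !inE /= /forward_to /= !andbT.
case/and4P => h2_1 x_h2 h2_m h2_y /and4P[h1_3 x_h1 m_h1 h1_y].
have h1_h2 := back 1 3 h2 h1 isT isT h2_1 h1_3 nh.
pose zs := [:: (3, h1); (1, h2); (5, y); (2, m); (0, x)].
have zs4 : in_layers 4 zs by rewrite /in_layers /zs /= !lt_n // h1_3 h2_1 y5 m2 x0.
have zs8 : in_layers 8 zs by rewrite /in_layers /zs /= !lt_n // h1_3 h2_1 y5 m2 x0.
have [h6 [p1 [h6A p1A nhp]]] :=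
  no_big_pair (common_big zs4 (lt_n 4 isT) isT) (common_big zs8 (lt_n 8 isT) isT).
move: h6A p1A; rewrite !inE /= /forward_to /= !andbT.
case/andP => h6_4 /and5P[h1_h6 h2_h6 h6_y m_h6 x_h6].
case/andP => p1_8 /and5P[h1_p1 h2_p1 y_p1 m_p1 x_p1].
have p1_h6 := back 4 8 h6 p1 isT isT h6_4 p1_8 nhp.
have zs6 : in_layers 6 [:: (3, h1); (1, h2); (5, y); (2, m); (0, x); (4, h6); (8, p1)].
  by rewrite /in_layers /= !lt_n // h1_3 h2_1 y5 m2 x0 h6_4 p1_8.
(* Here a single vertex suffices; the chain only shows that the set is nonempty. *)
have [[|p2 u] /andP[_ p2A] Lu] := has_chain (common_big zs6 (lt_n 6 isT) isT).
  by move: L8; rewrite ltnNge (leq_trans Lu).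
have {p2A} : p2 \in common 6 [:: (3, h1); (1, h2); (5, y); (2, m); (0, x); (4, h6); (8, p1)].
  by case/andP: p2A.
rewrite inE /= /forward_to /= !andbT.
case/and5P => p2_6 h1_p2 h2_p2 y_p2 /and4P[m_p2 x_p2 h6_p2 p2_p1].
have [||w [w_ch w_size zw]] := tail
  [:: (3, h1); (1, h2); (5, y); (2, m); (0, x); (4, h6); (8, p1); (6, p2)].
- by [].
- by rewrite /in_layers /= !lt_n // h1_3 h2_1 y5 m2 x0 h6_4 p1_8 p2_6.
apply: C5_chain_embeds w_ch w_size zw.
by rewrite /= h1_h2 h1_y h2_y h2_m ym yx m_h1 mx x_h1 x_h2 h1_h6 h2_h6 m_h6 x_h6 h6_y
  h1_p1 h2_p1 y_p1 m_p1 x_p1 p1_h6 h1_p2 h2_p2 y_p2 m_p2 x_p2 h6_p2 p2_p1.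
Qed.

End SmoothLayers.

(** * The Erdős–Hajnal property *)

(** Passing from the subsets of size [#|W| %/ C] to [W] multiplies the guaranteed chain length by
    [9 / 8]. Otherwise [W] has the near-maximality used above, and a C5-chain embeds. *)
Lemma C5_chain_growth t : exists2 C, 1 < C &
  forall T : tournament, ~ embeds (C5_chain_of t) T ->
  forall (W : {set T}) L, C <= #|W| -> 2 * t + 8 <= L ->
  (forall B : {set T}, B \subset W -> #|B| = #|W| %/ C ->
    exists2 s, chain B s & L <= size s) ->
  exists2 s, chain W s & 9 * L <= 8 * size s.
Proof.
have [C C0 HC] := smooth_layers (C5_chain_of t) 10 (isT : 0 < 64).
exists (8 * C) => [|T HT W L CW tL W_chain]; first by lia.
have [|A [AW Asm]] := HC T HT W; first by lia.
apply: contrapT => no_chain; apply: HT.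
have has_chain B : big W (8 * C) B -> exists2 s, chain B s & L <= size s.
  case/andP => BW WB.
  have [|B' B'B B'card] := @subset_of_card T (#|W| %/ (8 * C)) B.
    rewrite -(leq_pmul2l C0) -(leq_pmul2l (isT : 0 < 8)) !mulnA mulnC.
    exact: leq_trans (leq_trunc_div _ _) WB.
  have [|s s_ch Ls] := W_chain B' _ B'card; first exact: subset_trans BW.
  by exists s => //; apply: chain_sub s_ch.
have cat_nonarc s1 s2 : chain W s1 -> chain W s2 -> 9 * L <= 8 * (size s1 + size s2) ->
    exists x y, [/\ x \in s1, y \in s2 & ~~ arc x y].
  move=> ch1 ch2 sL; have [/allrelP s12|] := boolP (allrel (@arc T) s1 s2).
    by case: no_chain; exists (s1 ++ s2); [apply: chain_cat|rewrite size_cat].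
  by case/allPn => x xs /allPn[y ys xy]; exists x, y.
have big_chain B : big W (8 * C) B ->
    exists s, [/\ chain W s, L <= size s & {subset s <= B}].
  move=> bigB; have [s s_ch Ls] := has_chain _ bigB; exists s; split=> //.
    by apply: chain_sub s_ch; case/andP: bigB.
  by have /andP[_ /allP] := s_ch.
apply: (@layers_C5_chain T W A 10 (8 * C) L) => //; try lia.
- by move=> i /AW[? ?]; split=> //; rewrite -mulnA leq_mul2l.
- move=> B D /big_chain[s1 [ch1 L1 s1B]] /big_chain[s2 [ch2 L2 s2D]].
  have [|x [y [xs ys xy]]] := cat_nonarc s1 s2 ch1 ch2; first by lia.
  by exists x, y; split; auto.
- move=> B s2 /big_chain[s1 [ch1 L1 s1B]] ch2 L2.
  have [|x [y [xs ys xy]]] := cat_nonarc s1 s2 ch1 ch2; first by lia.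
  by exists x, y; split; auto.
- move=> B s1 /big_chain[s2 [ch2 L2 s2B]] ch1 L1.
  have [|x [y [xs ys xy]]] := cat_nonarc s1 s2 ch1 ch2; first by lia.
  by exists x, y; split; auto.
Qed.

(** * From the growth factor to a power of the size *)

Import Order.TTheory GRing.Theory Num.Theory.
Local Open Scope ring_scope.

Lemma powR_root (R : realType) (D : nat) (a : R) : (1 < D)%N -> 1 < a ->
  exists2 eps : R, 0 < eps & D%:R `^ eps = a.
Proof.
move=> D1 a1; have lnD : 0 < ln (D%:R : R) by rewrite ln_gt0 // ltr1n.
exists (ln a / ln D%:R); first by rewrite divr_gt0 // ln_gt0.
rewrite /powR pnatr_eq0 -leqn0 leqNgt (ltnW D1) /= divfK ?gt_eqF // lnK //.
by rewrite posrE (lt_trans _ a1).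
Qed.

Lemma nat_ceil (R : realType) (a : R) : exists L, forall k : nat, (a <= k%:R) = (L <= k)%N.
Proof.
have ex : exists k : nat, a <= k%:R.
  exists (Num.bound `|a|); apply: le_trans (ler_norm a) _.
  exact/ltW/archi_boundP.
case: (ex_minnP ex) => L aL Lmin; exists L => k; apply/idP/idP; first exact: Lmin.
by move=> Lk; apply: le_trans aL _; rewrite ler_nat.
Qed.

(** Induction on the size of [W]: the exponent satisfies [D ^ eps = 9 / 8], so one growth step pays
    for dividing the size by up to [D]. *)
Lemma C5_chain_chains (R : realType) t : exists2 eps : R, 0 < eps &
  forall T : tournament, ~ embeds (C5_chain_of t) T -> forall W : {set T},
  exists2 s, chain W s & #|W|%:R `^ eps <= (size s)%:R.
Proof.
have [C C1 HC] := C5_chain_growth t.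
(* By [chain_ramsey], [N] vertices already contain a chain as long as the growth step demands. *)
pose N := (2 ^ (2 * t + 8))%N; have N0 : (0 < N)%N by rewrite expn_gt0.
pose D := (2 * C * N)%N; have D1 : (1 < D)%N by rewrite /D; nia.
have a1 : 1 < 9 / 8 :> R by lra.
have [eps eps0 Deps] := powR_root D1 a1.
exists eps => // T HT W; have [n] := ubnP #|W|; elim: n W => // n IH W.
rewrite ltnS => Wn.
have mono (a b : nat) : (a <= b)%N -> a%:R `^ eps <= b%:R `^ eps :> R.
  by move=> ab; apply: ge0_ler_powR; rewrite ?nnegrE ?ler0n ?ler_nat // ltW.
have [W0|W0] := posnP #|W|.
  by exists [::]; rewrite // W0 powR0 ?gt_eqF.
have [W1|W1] := leqP #|W| 1.
  have [|s s_ch sz] := @chain_ramsey T 0 W; first by [].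
  by exists s => //; rewrite sz; apply: le_trans (mono _ _ W1) _; rewrite powR1.
(* Below [C * N] the required length is at most [D ^ eps = 9 / 8], so two vertices suffice. *)
have [WC|WC] := ltnP #|W| (C * N).
  have [|s s_ch sz] := @chain_ramsey T 1 W; first by [].
  exists s => //; rewrite sz; apply: (@le_trans _ _ (D%:R `^ eps)); last by rewrite Deps; lra.
  by apply: mono; rewrite /D; lia.
pose m := (#|W| %/ C)%N.
have Nm : (N <= m)%N by rewrite leq_divRL 1?mulnC // ltnW.
have Wm : (#|W| <= 2 * C * m)%N.
  by have := ltn_ceil #|W| (ltnW C1); rewrite -/m; nia.
have mW : (m < #|W|)%N by apply: ltn_Pdiv.
have [L0 HL0] := nat_ceil (m%:R `^ eps : R).
(* The induction hypothesis supplies [L0], the rounded-up value of [m ^ eps]; if this is below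
   [2 * t + 8], the bound from [N <= m] takes over. *)
pose L := maxn L0 (2 * t + 8).
have [||B BW Bm|s s_ch Ls] := HC T HT W L.
- by nia.
- exact: leq_maxr.
- have [|s1 ch1 s1m] := IH B; first by rewrite Bm; apply: leq_trans Wn.
  rewrite Bm HL0 in s1m.
  have [|s2 ch2 s2t] := @chain_ramsey T (2 * t + 8) B; first by rewrite Bm.
  have [L0t|tL0] := leqP L0 (2 * t + 8).
    by exists s2; rewrite // s2t /L (maxn_idPr L0t).
  by exists s1; rewrite // /L (maxn_idPl (ltnW tL0)).
exists s => //; apply: le_trans (mono _ _ Wm) _.
apply: le_trans (mono _ (D * m)%N _) _; first by rewrite leq_mul2r leq_pmulr ?orbT.
rewrite natrM powRM // Deps.
have : m%:R `^ eps <= L%:R :> R by rewrite HL0 leq_maxl.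
have : 9 * L%:R <= 8 * (size s)%:R :> R by rewrite -!natrM ler_nat.
lra.
Qed.

Theorem theorem17 (R : realType) (H : tournament) :
  C5_chain H -> erdos_hajnal R H.
Proof.
case=> t [g _ g_arc]; have [eps eps0 Heps] := C5_chain_chains R t.
exists eps; split=> // T noH.
have [|s /andP[ch _]] := Heps T _ [set: T].
  case=> f f_arc; apply: noH; apply: embeds_contains.
  by exists (f \o g) => u v uv; apply: f_arc; rewrite g_arc.
rewrite cardsT -(chain_card ch) => Ts.
by exists [set x in s]; split; [apply: chain_transitive|].
Qed.
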